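(* Let $f\colon[0,1]\to[0,1]$ be a continuous map of type $2^\infty$. Then $\mathrm{Prox}(f)=\mathrm{SProx}(f)$.
   Context: $f$ is of type $2^\infty$ if the set of (prime) periods of periodic points of $f$ equals $\{1,2,4,8,\dots\}=\{2^n:n\ge0\}$. $\mathrm{Prox}(f)=\{(x,y):\liminf_n|f^nx-f^ny|=0\}$; $\mathrm{SProx}(f)=\{(x,y):\{n\in\mathbb N:|f^nx-f^ny|<\varepsilon\}$ is syndetic for every $\varepsilon>0\}$, where a set is syndetic if it meets every subset of $\mathbb N$ containing arbitrarily long runs of consecutive integers. *)

(* Defs.v *)
From Stdlib Require Import Reals Lra Lia.
Open Scope R_scope.

Definition I01 (x : R) : Prop := 0 <= x <= 1.

Definition maps_I01 (f : R -> R) : Prop := forall x, I01 x -> I01 (f x).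

Definition continuous_on_I01 (f : R -> R) : Prop :=
  forall x, I01 x -> forall eps, eps > 0 ->
    exists delta, delta > 0 /\
      forall y, I01 y -> Rabs (y - x) < delta -> Rabs (f y - f x) < eps.

Definition iter_f (f : R -> R) (n : nat) (x : R) : R := Nat.iter n f x.

Definition has_prime_period (f : R -> R) (x : R) (n : nat) : Prop :=
  (n >= 1)%nat /\ iter_f f n x = x /\
  forall k, (1 <= k < n)%nat -> iter_f f k x <> x.

Definition type_2_infty (f : R -> R) : Prop :=
  forall n : nat,
    (exists x, I01 x /\ has_prime_period f x n) <-> (exists k : nat, n = (2 ^ k)%nat).

Definition thick (T : nat -> Prop) : Prop :=
  forall L : nat, exists m : nat, forall i : nat, (i < L)%nat -> T (m + i)%nat.

Definition syndetic (S : nat -> Prop) : Prop :=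
  forall T : nat -> Prop, thick T -> exists n, S n /\ T n.

(* Proximal pairs: liminf_n |f^n x - f^n y| = 0 (distances are >= 0). *)
Definition Prox (f : R -> R) (x y : R) : Prop :=
  I01 x /\ I01 y /\
  forall eps, eps > 0 -> forall N : nat, exists n, (n >= N)%nat /\
    Rabs (iter_f f n x - iter_f f n y) < eps.

Definition SProx (f : R -> R) (x y : R) : Prop :=
  I01 x /\ I01 y /\
  forall eps, eps > 0 ->
    syndetic (fun n => Rabs (iter_f f n x - iter_f f n y) < eps).

(* Main.v *)
(* Every power [g] of [f] of the form [f^(2^k)] has no periodic point of odd period
   greater than one, which rules out loops of odd total length among intervals
   covering one another, unless the loop contains a fixed point of [g]. Hence along an
   orbit of [g] the points moving right lie to the left of those moving left, and
   the orbit converges unless it eventually moves right and left alternately. So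
   either the even and the odd part of the orbit are eventually separated by a
   point, or the orbit converges. In both cases, passing from residue classes of
   times modulo [2^k] to classes modulo [2^(k+1)] splits the length of an interval
   containing the tail of the orbit of [x] in the class into two parts; doing
   this for [x] and [y] at once, one of the two new classes has at most half of
   the total length. So in some class modulo a large [2^k] both tails have small
   diameter, and if [x] and [y] are proximal these tails are also close to each
   other: their distance is then small along a whole arithmetic progression. *)
Require Import Defs.
From Stdlib Require Import Reals Lra Lia Classical Wf_nat.
Open Scope R_scope.

(** * Extremal preimages under a continuous function *)

Lemma continuity_eps (F : R -> R) (x eps : R) :
  continuity F -> 0 < eps ->
  exists d, 0 < d /\ forall y, Rabs (y - x) < d -> Rabs (F y - F x) < eps.
Proof.
  intros HF He. destruct (HF x eps He) as [d [Hd H]].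
  exists d; split; [exact Hd|]. intros y Hy.
  destruct (Req_dec x y) as [<-|Hxy].
  - replace (F x - F x) with 0 by ring. now rewrite Rabs_R0.
  - apply (H y). split; [split; [exact I|exact Hxy]|exact Hy].
Qed.

(** The point is the supremum of the [t] in [[a,b]] with [F t <= w]; continuity excludes both strict
    inequalities there. *)
Lemma last_level (F : R -> R) (a b w : R) :
  continuity F -> a <= b -> F a <= w <= F b ->
  exists p, a <= p <= b /\ F p = w /\ forall t, p < t <= b -> w < F t.
Proof.
  intros HF Hab Hw.
  destruct (completeness (fun t => a <= t <= b /\ F t <= w)) as [p [Hub Hlub]].
  - exists b. intros t [Ht _]. lra.
  - exists a. lra.
  - assert (Hap : a <= p) by (apply Hub; lra).
    assert (Hpb : p <= b) by (apply Hlub; intros t [Ht _]; lra).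
    assert (Habove : forall t, p < t <= b -> w < F t).
    { intros t Ht. destruct (Rlt_dec w (F t)) as [|Hn]; [assumption|].
      assert (t <= p) by (apply Hub; lra). lra. }
    assert (Hpw : F p <= w).
    { destruct (Rle_dec (F p) w) as [|Hn]; [assumption|].
      destruct (continuity_eps F p (F p - w) HF) as [d [Hd H]]; [lra|].
      assert (p <= p - d); [|lra].
      apply Hlub. intros t [Ht Hle].
      assert (t <= p) by (apply Hub; lra).
      destruct (Rle_dec t (p - d)) as [|Hn']; [assumption|].
      assert (Hc : Rabs (t - p) < d) by (apply Rabs_def1; lra).
      apply H in Hc. apply Rabs_def2 in Hc. lra. }
    exists p. repeat split; auto.
    destruct (Rle_lt_or_eq_dec _ _ Hpw) as [Hlt|]; [exfalso|assumption].
    destruct (continuity_eps F p (w - F p) HF) as [d [Hd H]]; [lra|].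
    assert (p < b).
    { destruct (Rle_lt_or_eq_dec _ _ Hpb) as [|E]; [assumption|].
      rewrite E in Hlt. lra. }
    set (t := Rmin b (p + d / 2)).
    assert (p < t <= b).
    { unfold t. split; [apply Rmin_glb_lt; lra|apply Rmin_l]. }
    assert (t <= p + d / 2) by apply Rmin_r.
    assert (Hc : Rabs (t - p) < d) by (apply Rabs_def1; lra).
    apply H in Hc. apply Rabs_def2 in Hc.
    specialize (Habove t). lra.
Qed.

Lemma continuity_mirror (F : R -> R) :
  continuity F -> continuity (fun t => - F (- t)).
Proof.
  intros HF. change (continuity (- (comp F (- id)))%F).
  apply continuity_opp, continuity_comp; [|assumption].
  apply continuity_opp. intro x. apply derivable_continuous_pt, derivable_pt_id.
Qed.

Lemma first_level (F : R -> R) (a b w : R) :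
  continuity F -> a <= b -> F a <= w <= F b ->
  exists p, a <= p <= b /\ F p = w /\ forall t, a <= t < p -> F t < w.
Proof.
  intros HF Hab Hw.
  destruct (last_level (fun t => - F (- t)) (- b) (- a) (- w))
    as (p & Hp & E & H).
  - now apply continuity_mirror.
  - lra.
  - rewrite !Ropp_involutive. lra.
  - exists (- p). repeat split; try lra.
    intros t Ht. specialize (H (- t)). rewrite Ropp_involutive in H. lra.
Qed.

Lemma intermediate_value (F : R -> R) (a b s1 s2 t : R) :
  continuity F -> a <= s1 <= b -> a <= s2 <= b -> F s1 <= t <= F s2 ->
  exists s, a <= s <= b /\ F s = t.
Proof.
  intros HF H1 H2 Ht. destruct (Rle_dec s1 s2) as [Hs|Hs].
  - destruct (last_level F s1 s2 t HF Hs Ht) as (p & Hp & E & _).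
    exists p. split; [lra|assumption].
  - destruct (last_level (- F)%F s2 s1 (- t)) as (p & Hp & E & _).
    + now apply continuity_opp.
    + lra.
    + unfold opp_fct. lra.
    + exists p. unfold opp_fct in E. lra.
Qed.

Lemma tight_preimage_ordered (F : R -> R) (p q : R) :
  continuity F -> p <= q -> F p <= F q ->
  exists p' q', p <= p' <= q' /\ q' <= q /\ F p' = F p /\ F q' = F q /\
    forall t, p' <= t <= q' -> F p <= F t <= F q.
Proof.
  intros HF Hpq Hv.
  destruct (last_level F p q (F p) HF Hpq) as (p' & Hp & Ep & Hp'); [lra|].
  destruct (first_level F p' q (F q) HF) as (q' & Hq & Eq & Hq'); [lra|lra|].
  exists p', q'. repeat split; try lra.
  - destruct (Rle_lt_or_eq_dec p' t) as [Ht|<-]; [lra| |lra].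
    left. apply Hp'. lra.
  - destruct (Rle_lt_or_eq_dec t q') as [Ht| ->]; [lra| |lra].
    left. apply Hq'. lra.
Qed.

(** Between the last point of one value and the first later point of the other, no value leaves the
    range; negating [F] covers decreasing values. The order of [p'] and [q'] is that of [p] and [q],
    hence [Rmin] and [Rmax]. *)
Lemma tight_preimage (F : R -> R) (a b p q l1 l2 : R) :
  continuity F -> a <= p <= b -> a <= q <= b ->
  l1 <= F p <= l2 -> l1 <= F q <= l2 ->
  exists p' q', a <= p' <= b /\ a <= q' <= b /\ F p' = F p /\ F q' = F q /\
    forall t, Rmin p' q' <= t <= Rmax p' q' -> l1 <= F t <= l2.
Proof.
  revert p q.
  assert (Hord : forall p q, p <= q -> continuity F -> a <= p <= b ->
    a <= q <= b -> l1 <= F p <= l2 -> l1 <= F q <= l2 ->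
    exists p' q', p' <= q' /\ a <= p' <= b /\ a <= q' <= b /\
      F p' = F p /\ F q' = F q /\ forall t, p' <= t <= q' -> l1 <= F t <= l2).
  { intros p q Hpq HF Hp Hq H1 H2. destruct (Rle_dec (F p) (F q)) as [Hv|Hv].
    - destruct (tight_preimage_ordered F p q HF Hpq Hv)
        as (p' & q' & A & B & C & D & E).
      exists p', q'. repeat split; try lra; specialize (E t ltac:(lra)); lra.
    - destruct (tight_preimage_ordered (- F)%F p q)
        as (p' & q' & A & B & C & D & E).
      + now apply continuity_opp.
      + assumption.
      + unfold opp_fct; lra.
      + unfold opp_fct in *.
        exists p', q'. repeat split; try lra; specialize (E t ltac:(lra)); lra. }
  intros p q HF Hp Hq H1 H2. destruct (Rle_dec p q) as [Hpq|Hpq].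
  - destruct (Hord p q) as (p' & q' & A & B & C & D & E & G); auto.
    exists p', q'. rewrite Rmin_left, Rmax_right by assumption. auto.
  - destruct (Hord q p) as (q' & p' & A & B & C & D & E & G); auto; [lra|].
    exists p', q'. rewrite Rmin_right, Rmax_left by assumption. auto.
Qed.

(** * Iterates and covering relations between intervals *)

Lemma iter_f_S (g : R -> R) (n : nat) (x : R) : iter_f g (S n) x = g (iter_f g n x).
Proof. reflexivity. Qed.

Lemma iter_f_add (g : R -> R) (n m : nat) (x : R) :
  iter_f g (n + m) x = iter_f g n (iter_f g m x).
Proof. induction n as [|n IH]; [reflexivity|]. simpl Nat.add. now rewrite !iter_f_S, IH. Qed.

Lemma iter_f_mul (g : R -> R) (n m : nat) (x : R) :
  iter_f (iter_f g n) m x = iter_f g (n * m) x.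
Proof.
  induction m as [|m IH].
  - now rewrite Nat.mul_0_r.
  - replace (n * S m)%nat with (n + n * m)%nat by lia.
    now rewrite iter_f_add, <- IH.
Qed.

Lemma iter_f_fixed (g : R -> R) (n : nat) (z : R) : g z = z -> iter_f g n z = z.
Proof. intros Hz. induction n as [|n IH]; [reflexivity|]. now rewrite iter_f_S, IH. Qed.

Lemma continuity_iter_f (g : R -> R) (n : nat) :
  continuity g -> continuity (iter_f g n).
Proof.
  intros Hg. induction n as [|n IH].
  - intro x. apply derivable_continuous_pt, derivable_pt_id.
  - exact (continuity_comp _ _ IH Hg).
Qed.

Definition covers (g : R -> R) (n : nat) (a1 a2 b1 b2 : R) : Prop :=
  forall t, b1 <= t <= b2 -> exists s, a1 <= s <= a2 /\ iter_f g n s = t.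

Lemma covers_trans (g : R -> R) (n m : nat) (a1 a2 b1 b2 c1 c2 : R) :
  covers g n a1 a2 b1 b2 -> covers g m b1 b2 c1 c2 ->
  covers g (m + n) a1 a2 c1 c2.
Proof.
  intros H1 H2 t Ht. destruct (H2 t Ht) as (s & Hs & E).
  destruct (H1 s Hs) as (r & Hr & E'). exists r. split; [assumption|].
  now rewrite iter_f_add, E', E.
Qed.

Lemma covers_of_values (g : R -> R) (n : nat) (a1 a2 b1 b2 s1 s2 : R) :
  continuity g -> a1 <= s1 <= a2 -> a1 <= s2 <= a2 ->
  iter_f g n s1 <= b1 -> b2 <= iter_f g n s2 -> covers g n a1 a2 b1 b2.
Proof.
  intros Hg H1 H2 E1 E2 t Ht.
  apply (intermediate_value (iter_f g n) a1 a2 s1 s2); auto; [|lra].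
  now apply continuity_iter_f.
Qed.

(** * Odd loops and the order of ascending and descending points *)

(** Periods here need not be prime, as a loop of intervals only yields some period. *)
Definition odd_periods_trivial (g : R -> R) : Prop :=
  forall j y, iter_f g (S (2 * j)) y = y -> g y = y.

(** Pulling [v1] and [v2] back around the loop gives [p] and [q], between which the iterate of order
    [2 * j + 1] minus the identity changes sign. Its zero is fixed by [g]; tightening [p], [q] first
    keeps the image of the zero, hence the zero itself, in [[l1,l2]]. *)
Lemma odd_loop (g : R -> R) (j : nat) (v1 v2 l1 l2 : R) :
  continuity g -> odd_periods_trivial g -> v1 <= v2 ->
  covers g 1 v1 v2 l1 l2 -> covers g (2 * j) l1 l2 v1 v2 ->
  exists y, v1 <= y <= v2 /\ l1 <= y <= l2 /\ g y = y.
Proof.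
  intros Hg Hodd Hv H1 H2.
  destruct (H2 v1) as (w1 & Hw1 & E1); [lra|].
  destruct (H2 v2) as (w2 & Hw2 & E2); [lra|].
  destruct (H1 w1 Hw1) as (p & Hp & Ep).
  destruct (H1 w2 Hw2) as (q & Hq & Eq).
  simpl in Ep, Eq.
  destruct (tight_preimage g v1 v2 p q l1 l2)
    as (p' & q' & Hp' & Hq' & Ep' & Eq' & Ht); auto; try (subst; lra).
  set (m := Rmin p' q'). set (M := Rmax p' q').
  assert (m <= p' /\ m <= q') by (split; [apply Rmin_l|apply Rmin_r]).
  assert (p' <= M /\ q' <= M) by (split; [apply Rmax_l|apply Rmax_r]).
  assert (v1 <= m) by (apply Rmin_glb; lra).
  assert (M <= v2) by (apply Rmax_lub; lra).
  assert (Hcomm : forall y, iter_f g (2 * j) (g y) = iter_f g (S (2 * j)) y).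
  { intro y. replace (S (2 * j)) with (2 * j + 1)%nat by lia. now rewrite iter_f_add. }
  destruct (intermediate_value (iter_f g (S (2 * j)) - id)%F m M p' q' 0)
    as (y & Hy & E).
  - apply continuity_minus; [now apply continuity_iter_f|].
    intro x. apply derivable_continuous_pt, derivable_pt_id.
  - lra.
  - lra.
  - unfold minus_fct, id. rewrite <- !Hcomm, Ep', Eq', Ep, Eq, E1, E2. lra.
  - assert (Hfix : g y = y).
    { apply (Hodd j). unfold minus_fct, id in E. lra. }
    exists y. specialize (Ht y Hy). rewrite Hfix in Ht.
    repeat split; lra.
Qed.

(** At a first failure, [v] lies beyond [u] and [g v <= c]. Then [[u,v]], [[c,u]], [[c,u]], [[u,v]]
    is a loop of length [1 + j + j], whose fixed point could only be [u]. *)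
Lemma orbit_stays_above (g : R -> R) (c u : R) :
  continuity g -> odd_periods_trivial g -> g c = c -> c < u ->
  (forall t, c < t <= u -> t < g t) -> forall j, c < iter_f g j u.
Proof.
  intros Hg Hodd Hc Hcu Hup j. induction j as [|j IH]; [exact Hcu|].
  destruct (Rlt_dec c (iter_f g (S j) u)) as [|Hn]; [assumption|exfalso].
  rewrite iter_f_S in Hn. set (v := iter_f g j u) in *.
  assert (u < v).
  { destruct (Rlt_dec u v) as [|Hn']; [assumption|].
    specialize (Hup v). lra. }
  specialize (Hup u).
  assert (Hcv : covers g j c u c v).
  { apply (covers_of_values g j c u c v c u); auto; try lra.
    - rewrite iter_f_fixed; auto; lra.
    - fold v. lra. }
  destruct (odd_loop g j u v c u) as (y & Hy1 & Hy2 & E); auto; [lra| | |].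
  - apply (covers_of_values g 1 u v c u v u); auto; simpl; lra.
  - replace (2 * j)%nat with (j + j)%nat by lia.
    apply (covers_trans g j j c u c u u v); intros t Ht; apply Hcv; lra.
  - replace y with u in E by lra. lra.
Qed.

(** Conjugation by the reflection at 0, which exchanges ascents and descents. *)
Definition mirror (g : R -> R) (t : R) : R := - g (- t).

Lemma iter_mirror (g : R -> R) (n : nat) (x : R) :
  iter_f (mirror g) n x = - iter_f g n (- x).
Proof.
  induction n as [|n IH]; [simpl; ring|].
  rewrite !iter_f_S, IH.
  unfold mirror. now rewrite Ropp_involutive.
Qed.

Lemma odd_periods_trivial_mirror (g : R -> R) :
  odd_periods_trivial g -> odd_periods_trivial (mirror g).
Proof.
  intros H j y E. rewrite iter_mirror in E. unfold mirror.
  rewrite (H j (- y)); lra.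
Qed.

Lemma orbit_stays_below (g : R -> R) (c d : R) :
  continuity g -> odd_periods_trivial g -> g c = c -> d < c ->
  (forall t, d <= t < c -> g t < t) -> forall j, iter_f g j d < c.
Proof.
  intros Hg Hodd Hc Hdc Hdn j.
  assert (H : - c < iter_f (mirror g) j (- d)).
  { apply orbit_stays_above.
    - now apply continuity_mirror.
    - now apply odd_periods_trivial_mirror.
    - unfold mirror. now rewrite Ropp_involutive, Hc.
    - lra.
    - intros t Ht. unfold mirror. specialize (Hdn (- t)). lra. }
  rewrite iter_mirror, Ropp_involutive in H. lra.
Qed.

(* If a descending point [d] lay left of an ascending point [u], a fixed point
   between them would trap the orbit of [u] above and that of [d] below. *)
Lemma ascending_left_of_descending (g : R -> R) (x : R) (m n : nat) :
  continuity g -> odd_periods_trivial g ->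
  iter_f g m x < iter_f g (S m) x -> iter_f g (S n) x < iter_f g n x ->
  iter_f g m x < iter_f g n x.
Proof.
  intros Hg Hodd. rewrite !iter_f_S.
  set (u := iter_f g m x). set (d := iter_f g n x). intros Hu Hd.
  destruct (Rlt_dec u d) as [|Hn]; [assumption|exfalso].
  assert (Hdu : d < u).
  { destruct (Req_dec u d) as [E|]; [rewrite E in Hu|]; lra. }
  assert (HF : continuity (g - id)%F).
  { apply continuity_minus; [assumption|].
    intro t. apply derivable_continuous_pt, derivable_pt_id. }
  destruct (last_level (g - id)%F d u 0 HF) as (c & Hc & Ec & Hup);
    [lra|unfold minus_fct, id; lra|].
  destruct (first_level (g - id)%F d u 0 HF) as (c' & Hc' & Ec' & Hdn);
    [lra|unfold minus_fct, id; lra|].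
  unfold minus_fct, id in *.
  assert (c' <= c).
  { destruct (Rle_dec c' c) as [|Hn']; [assumption|].
    specialize (Hdn c). lra. }
  assert (c <> u) by (intros ->; lra).
  assert (c' <> d) by (intros ->; lra).
  (* The orbits of [u] and [d] share the iterate of order [m + n], which would lie above [c] and
     below [c' <= c]. *)
  assert (Hlow : c < iter_f g (n + m) x).
  { rewrite iter_f_add. fold u. apply orbit_stays_above; auto; try lra.
    intros t Ht. specialize (Hup t). lra. }
  assert (Hhigh : iter_f g (m + n) x < c').
  { rewrite iter_f_add. fold d. apply orbit_stays_below; auto; try lra.
    intros t Ht. specialize (Hdn t). lra. }
  rewrite Nat.add_comm in Hhigh. lra.
Qed.

(* The intervals [[z,v]], [[a, g a]], [[g a, z]] form a loop of length [s + 2] and,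
   omitting the second one, a loop of length [s + 1]; running through both gives
   a loop of odd length whose periodic point cannot be fixed. *)
Lemma no_return_after_double_ascent (g : R -> R) (z a v t : R) (s : nat) :
  continuity g -> odd_periods_trivial g -> g z = z ->
  a <= g a < z -> z <= g (g a) -> z <= v -> g v <= a ->
  g a <= t <= z -> iter_f g s t = v -> False.
Proof.
  intros Hg Hodd Hz Ha Hb Hv Hva Ht Hs. set (b := g a) in *.
  assert (HBV : covers g s b z z v).
  { apply (covers_of_values g s b z z v z t); auto; try lra.
    rewrite iter_f_fixed; auto; lra. }
  assert (HV : covers g 1 z v a z).
  { apply (covers_of_values g 1 z v a z v z); auto; simpl; lra. }
  assert (HVB : covers g 1 z v b z) by (intros r Hr; apply HV; lra).
  assert (HAB : covers g 1 a b b z).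
  { apply (covers_of_values g 1 a b b z a b); auto; simpl; fold b; lra. }
  (* The loop starts with the step from [[z,v]] to [[a,b]]; these two intervals are disjoint since
     [b < z]. *)
  destruct (odd_loop g (S s) z v a b) as (y & Hy1 & Hy2 & _); auto.
  - intros r Hr; apply HV; lra.
  - replace (2 * S s)%nat with (s + (1 + (s + 1)))%nat by lia.
    apply (covers_trans g (1 + (s + 1)) s a b b z z v); [|assumption].
    apply (covers_trans g (s + 1) 1 a b z v b z); [|assumption].
    now apply (covers_trans g 1 s a b b z z v).
  - lra.
Qed.

(** * Convergence or alternation of orbits *)

(** Take the last descent before [n]: from there the sequence rises up to [X n]. *)
Lemma last_descent (X : nat -> R) (m n : nat) :
  (forall i, X (S i) <> X i) -> (m < n)%nat ->
  X (S m) < X m -> X n < X (S n) ->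
  exists l, (m <= l < n)%nat /\ X (S l) < X l /\ X (S l) <= X n.
Proof.
  intros Hne. induction n as [|n IH]; intros Hmn Hm Hn; [lia|].
  destruct (Rtotal_order (X (S n)) (X n)) as [Hlt|[E|Hgt]].
  - exists n. repeat split; try lia; lra.
  - now destruct (Hne n).
  - assert (m <> n) by (intros ->; lra).
    destruct IH as (l & Hl & Hd & Hle); [lia|assumption|lra|].
    exists l. repeat split; try lia; lra.
Qed.

(** The descent at [n + d] ends the run of ascents starting at [n]; [k] begins its last two
    ascents. *)
Lemma ascent_run_end (X : nat -> R) (d n : nat) :
  (forall i, X (S i) <> X i) ->
  X n < X (S n) -> X (S n) < X (S (S n)) -> X (S (n + d)) < X (n + d)%nat ->
  exists k, (n <= k)%nat /\ X k < X (S k) /\ X (S k) < X (S (S k)) /\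
    X (S (S (S k))) < X (S (S k)).
Proof.
  intros Hne. revert n. induction d as [|d IH]; intros n H1 H2 Hd.
  - rewrite Nat.add_0_r in Hd. lra.
  - destruct (Rtotal_order (X (S (S (S n)))) (X (S (S n)))) as [Hlt|[E|Hgt]].
    + exists n. auto.
    + now destruct (Hne (S (S n))).
    + destruct (IH (S n)) as (k & Hk & Hrest); auto.
      * now replace (S n + d)%nat with (n + S d)%nat by lia.
      * exists k. split; [lia|assumption].
Qed.

(** Descending points lie above the supremum [s] of the ascending ones, and [s <= g s] because
    ascending points come arbitrarily close to [s]. The first fixed point [z] from [s] on works,
    since [g] moves points of [[s,z)] to the right. *)
Lemma separating_fixed_point (g : R -> R) (x s : R) :
  continuity g -> odd_periods_trivial g ->
  (exists n, iter_f g (S n) x < iter_f g n x) ->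
  is_lub (fun r => exists n, r = iter_f g n x /\ r < g r) s ->
  exists z, g z = z /\ s <= z /\
    forall n, iter_f g (S n) x < iter_f g n x -> z <= iter_f g n x.
Proof.
  intros Hg Hodd [n0 Hn0] [Hub Hlub].
  assert (HsD : forall n, iter_f g (S n) x < iter_f g n x -> s <= iter_f g n x).
  { intros n Hn. apply Hlub. intros r (m & -> & Hm). left.
    now apply ascending_left_of_descending. }
  assert (Hs : s <= g s).
  { destruct (Rle_dec s (g s)) as [|Hn]; [assumption|exfalso].
    destruct (continuity_eps g s ((s - g s) / 2) Hg) as (d & Hd & Hc); [lra|].
    set (e := Rmin d ((s - g s) / 2)).
    assert (0 < e) by (apply Rmin_glb_lt; lra).
    assert (e <= d /\ e <= (s - g s) / 2) by (split; [apply Rmin_l|apply Rmin_r]).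
    assert (s <= s - e); [|lra].
    apply Hlub. intros r Hr. destruct (Rle_dec r (s - e)) as [|Hn']; [assumption|].
    assert (r <= s) by now apply Hub.
    destruct Hr as (m & _ & Hr).
    assert (Hc' : Rabs (r - s) < d) by (apply Rabs_def1; lra).
    apply Hc in Hc'. apply Rabs_def2 in Hc'. lra. }
  destruct (first_level (id - g)%F s (iter_f g n0 x) 0) as (z & Hz & Ez & Hbelow).
  - apply continuity_minus; [|assumption].
    intro t. apply derivable_continuous_pt, derivable_pt_id.
  - now apply HsD.
  - rewrite iter_f_S in Hn0. unfold minus_fct, id. lra.
  - unfold minus_fct, id in *. exists z. repeat split; try lra.
    intros n Hn. destruct (Rle_dec z (iter_f g n x)) as [|Hz']; [assumption|].
    specialize (HsD n Hn). rewrite iter_f_S in Hn.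
    specialize (Hbelow (iter_f g n x)). lra.
Qed.

(** If the point at time [m'] were not above the one at time [m], the iterates of [[g a, z]], with
    [a] the point at time [n], would cover the latter. Following the orbit from time [m] to time [l]
    would then give the return forbidden by [no_return_after_double_ascent]. *)
Lemma later_points_above (g : R -> R) (x z : R) (l m m' n : nat) :
  continuity g -> odd_periods_trivial g -> g z = z ->
  (m <= l < n)%nat -> (S n <= m')%nat ->
  z <= iter_f g l x -> iter_f g (S l) x <= iter_f g n x ->
  iter_f g n x < iter_f g (S n) x < z -> z <= iter_f g (S (S n)) x ->
  iter_f g m x <= z -> iter_f g m x < iter_f g m' x.
Proof.
  intros Hg Hodd Hz Hml Hm' Hl Hl' Hn Hn2 Hm.
  destruct (Rlt_dec (iter_f g m x) (iter_f g m' x)) as [|Hle]; [assumption|exfalso].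
  rewrite !iter_f_S in Hn, Hn2, Hl'.
  set (b := g (iter_f g n x)) in *.
  destruct (intermediate_value (iter_f g (m' - S n)) b z b z (iter_f g m x))
    as (t & Ht & Et); try lra.
  - now apply continuity_iter_f.
  - replace (iter_f g (m' - S n) b) with (iter_f g m' x).
    + rewrite (iter_f_fixed g _ z Hz). lra.
    + unfold b. rewrite <- iter_f_S, <- iter_f_add. f_equal. lia.
  - apply (no_return_after_double_ascent g z (iter_f g n x) (iter_f g l x) t
      ((l - m) + (m' - S n))); auto; fold b; try lra.
    rewrite iter_f_add, Et, <- iter_f_add. f_equal. lia.
Qed.

(* Each run of two or more ascents pushes the rest of the orbit above all earlier
   ascending points, so these converge to their supremum [s]; as [g] maps
   ascending points to ascending points infinitely often, [s] is fixed. *)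
Lemma cv_of_frequent_double_ascents (g : R -> R) (x : R) :
  continuity g -> odd_periods_trivial g ->
  (forall n, iter_f g (S n) x <> iter_f g n x) ->
  (forall N, exists n, (N <= n)%nat /\ iter_f g (S n) x < iter_f g n x) ->
  (forall N, exists n, (N <= n)%nat /\ iter_f g n x < iter_f g (S n) x /\
    iter_f g (S n) x < iter_f g (S (S n)) x) ->
  exists l, Un_cv (fun n => iter_f g n x) l.
Proof.
  intros Hg Hodd Hne HD HUU.
  set (X := fun n => iter_f g n x).
  assert (HXS : forall n, X (S n) = g (X n)) by reflexivity.
  change (forall n, X (S n) <> X n) in Hne.
  change (forall N, exists n, (N <= n)%nat /\ X (S n) < X n) in HD.
  change (forall N, exists n, (N <= n)%nat /\ X n < X (S n) /\ X (S n) < X (S (S n))) in HUU.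
  destruct (completeness (fun r => exists n, r = X n /\ r < g r)) as [s Hs].
  { destruct (HD O) as (n0 & _ & Hn0). exists (X n0). intros r (n & -> & Hn).
    left. now apply ascending_left_of_descending. }
  { destruct (HUU O) as (n0 & _ & Hn0 & _). exists (X n0), n0. auto. }
  destruct (separating_fixed_point g x s) as (z & Hz & Hsz & HzD); auto.
  { destruct (HD O) as (n0 & _ & Hn0). now exists n0. }
  fold X in HzD.
  destruct Hs as [Hub Hlub].
  assert (HUs : forall n, X n < X (S n) -> X n <= s).
  { intros n Hn. apply Hub. now exists n. }
  (* Arbitrarily late, [n] starts the last two ascents of a run, and [l] is the last descent before
     [n]. *)
  assert (Hevent : forall M, exists l n, (M <= l < n)%nat /\ X (S l) < X l /\
    X (S l) <= X n /\ X n < X (S n) /\ X (S n) < X (S (S n)) /\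
    X (S (S (S n))) < X (S (S n))).
  { intro M. destruct (HD M) as (m & Hm & Hdm).
    destruct (HUU (S m)) as (n & Hn & H1 & H2).
    destruct (HD n) as (d & Hd & Hdd).
    destruct (ascent_run_end X (d - n) n) as (k & Hk & K1 & K2 & K3); auto.
    { now replace (n + (d - n))%nat with d by lia. }
    destruct (last_descent X m k) as (l & Hl & L1 & L2); auto; [lia|].
    exists l, k. repeat split; auto; lia. }
  assert (Hlow : forall e, 0 < e -> exists N, forall n, (N <= n)%nat -> s - e < X n).
  { intros e He.
    assert (Hm : exists m, X m < X (S m) /\ s - e < X m).
    { apply NNPP. intro Hno. assert (s <= s - e); [|lra].
      apply Hlub. intros r (m & -> & Hm).
      destruct (Rle_dec (X m) (s - e)) as [|Hn]; [assumption|].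
      destruct Hno. exists m. split; [exact Hm|lra]. }
    destruct Hm as (m & Hm & Hme).
    destruct (Hevent m) as (l & n & Hln & L1 & L2 & N1 & N2 & N3).
    exists (S n). intros m' Hm'.
    assert (X m < X m'); [|lra].
    assert (z <= X (S (S n))) by now apply HzD.
    assert (X (S n) < z).
    { specialize (HUs (S n) N2).
      destruct (Req_dec (X (S n)) z) as [E|]; [|lra].
      rewrite (HXS (S n)), E in N2. lra. }
    apply (later_points_above g x z l m m' n); auto; fold (X m) (X n) (X l);
      try lia; try (now split).
    specialize (HUs m Hm). lra. }
  assert (Hfix : g s = s).
  { apply NNPP. intro Hn.
    set (e := Rabs (g s - s) / 2).
    assert (He : 0 < e).
    { unfold e. assert (0 < Rabs (g s - s)) by (apply Rabs_pos_lt; lra). lra. }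
    destruct (continuity_eps g s e Hg He) as (d & Hd & Hc).
    destruct (Hlow (Rmin d e)) as (N & HN); [now apply Rmin_glb_lt|].
    destruct (HUU N) as (n & Hn' & U1 & U2).
    assert (Rmin d e <= d /\ Rmin d e <= e) by (split; [apply Rmin_l|apply Rmin_r]).
    assert (A1 := HN n Hn'). assert (A2 := HN (S n) ltac:(lia)).
    apply HUs in U1 as B1. apply HUs in U2 as B2.
    assert (C1 : Rabs (X n - s) < d) by (apply Rabs_def1; lra).
    apply Hc in C1. rewrite <- HXS in C1.
    assert (C2 : Rabs (X (S n) - s) < e) by (apply Rabs_def1; lra).
    assert (Rabs (g s - s) < 2 * e); [|unfold e in *; lra].
    apply Rabs_def2 in C1. apply Rabs_def2 in C2. apply Rabs_def1; lra. }
  exists s. intros e He.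
  destruct (continuity_eps g s e Hg He) as (d & Hd & Hc).
  destruct (Hlow (Rmin d e)) as (N & HN); [now apply Rmin_glb_lt|].
  assert (Rmin d e <= d /\ Rmin d e <= e) by (split; [apply Rmin_l|apply Rmin_r]).
  destruct (HUU N) as (n0 & Hn0 & U0 & _).
  (* A descent preserves the bound; an ascent starts within [d] of [s], so it ends within [e] of
     [g s = s]. *)
  assert (Hall : forall k, X (n0 + k)%nat < s + e).
  { induction k as [|k IH].
    - rewrite Nat.add_0_r. specialize (HUs n0 U0). lra.
    - rewrite Nat.add_succ_r.
      destruct (Rtotal_order (X (S (n0 + k))) (X (n0 + k)%nat)) as [Hlt|[E|Hgt]].
      + lra.
      + now destruct (Hne (n0 + k)%nat).
      + assert (A := HN (n0 + k)%nat ltac:(lia)). apply HUs in Hgt.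
        assert (C : Rabs (X (n0 + k)%nat - s) < d) by (apply Rabs_def1; lra).
        apply Hc in C. rewrite Hfix in C. apply Rabs_def2 in C.
        rewrite HXS. lra. }
  exists n0. intros n Hn. unfold Rdist. fold (X n).
  specialize (Hall (n - n0)%nat). replace (n0 + (n - n0))%nat with n in Hall by lia.
  specialize (HN n ltac:(lia)). apply Rabs_def1; lra.
Qed.

Lemma cv_of_shift (X : nat -> R) (N : nat) (l : R) :
  Un_cv (fun n => X (N + n)%nat) l -> Un_cv X l.
Proof.
  intros H e He. destruct (H e He) as (M & HM). exists (N + M)%nat.
  intros n Hn. specialize (HM (n - N)%nat ltac:(lia)).
  now replace (N + (n - N))%nat with n in HM by lia.
Qed.

Lemma cv_of_mirror (g : R -> R) (x : R) :
  (exists l, Un_cv (fun n => iter_f (mirror g) n (- x)) l) ->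
  exists l, Un_cv (fun n => iter_f g n x) l.
Proof.
  intros [l H]. exists (- l). intros e He. destruct (H e He) as (N & HN).
  exists N. intros n Hn. specialize (HN n Hn). unfold Rdist in *.
  rewrite iter_mirror, Ropp_involutive in HN.
  rewrite <- Rabs_Ropp. now replace (- (iter_f g n x - - l)) with (- iter_f g n x - l) by ring.
Qed.

Lemma cv_of_eventually_ascending (X : nat -> R) (M : R) (N : nat) :
  (forall n, X n <= M) -> (forall n, (N <= n)%nat -> X n <= X (S n)) ->
  exists l, Un_cv X l.
Proof.
  intros HM HN. destruct (growing_cv (fun n => X (N + n)%nat)) as [l Hl].
  - intro n. rewrite Nat.add_succ_r. apply HN. lia.
  - exists M. intros r [n ->]. apply HM.
  - exists l. now apply (cv_of_shift X N).
Qed.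

(** Without convergence, descents recur, as otherwise the orbit would be eventually monotone and
    bounded; recurring double ascents would then force convergence. *)
Lemma eventually_no_double_ascent (g : R -> R) (x M : R) :
  continuity g -> odd_periods_trivial g -> (forall n, iter_f g n x <= M) ->
  (forall n, iter_f g (S n) x <> iter_f g n x) ->
  (exists l, Un_cv (fun n => iter_f g n x) l) \/
  (exists N, forall n, (N <= n)%nat -> iter_f g n x < iter_f g (S n) x ->
    iter_f g (S (S n)) x < iter_f g (S n) x) /\
  (forall N, exists n, (N <= n)%nat /\ iter_f g (S n) x < iter_f g n x).
Proof.
  intros Hg Hodd HM Hne.
  destruct (classic (exists l, Un_cv (fun n => iter_f g n x) l)) as [|Hcv]; [now left|right].
  assert (HD : forall N, exists n, (N <= n)%nat /\ iter_f g (S n) x < iter_f g n x).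
  { intro N. apply NNPP. intro Hno. apply Hcv.
    apply (cv_of_eventually_ascending _ M N HM).
    intros n Hn. destruct (Rle_dec (iter_f g n x) (iter_f g (S n) x)) as [|Hlt]; [assumption|].
    destruct Hno. exists n. split; [assumption|lra]. }
  split; [|assumption].
  apply NNPP. intro Hno. apply Hcv.
  apply cv_of_frequent_double_ascents; auto.
  intro N. apply NNPP. intro Hno'. apply Hno. exists N. intros n Hn Hup.
  destruct (Rtotal_order (iter_f g (S (S n)) x) (iter_f g (S n) x)) as [|[E|Hgt]].
  - assumption.
  - now destruct (Hne (S n)).
  - destruct Hno'. exists n. auto.
Qed.

Lemma cv_or_alternating (g : R -> R) (x M : R) :
  continuity g -> odd_periods_trivial g -> (forall n, - M <= iter_f g n x <= M) ->
  (exists l, Un_cv (fun n => iter_f g n x) l) \/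
  (exists z N, forall j, iter_f g (N + 2 * j) x <= z <= iter_f g (S (N + 2 * j)) x).
Proof.
  intros Hg Hodd HM.
  destruct (classic (forall n, iter_f g (S n) x <> iter_f g n x)) as [Hne|Heq].
  (* Two equal consecutive points make the orbit constant from there on. *)
  2: { left. apply not_all_ex_not in Heq as [n Hn]. apply NNPP in Hn.
    rewrite iter_f_S in Hn. apply (cv_of_eventually_ascending _ M n); [apply HM|].
    intros m Hm. rewrite iter_f_S. replace m with ((m - n) + n)%nat by lia.
    rewrite iter_f_add, (iter_f_fixed g (m - n) _ Hn). lra. }
  destruct (eventually_no_double_ascent g x M) as [|[[N1 HN1] HD]]; auto; [apply HM|].
  destruct (eventually_no_double_ascent (mirror g) (- x) M) as [Hcv|[[N2 HN2] HU]].
  - now apply continuity_mirror.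
  - now apply odd_periods_trivial_mirror.
  - intro n. rewrite iter_mirror, Ropp_involutive. specialize (HM n); lra.
  - intro n. rewrite !iter_mirror, Ropp_involutive. specialize (Hne n). lra.
  - left. now apply cv_of_mirror.
  - right.
    (* A descent of the mirrored orbit is an ascent at [N], after which neither double ascents nor
       double descents occur. *)
    destruct (HU (N1 + N2)%nat) as (N & HN & HNup).
    rewrite !iter_mirror, Ropp_involutive in HNup.
    assert (Halt : forall j,
      iter_f g (N + 2 * j) x < iter_f g (S (N + 2 * j)) x /\
      iter_f g (S (S (N + 2 * j))) x < iter_f g (S (N + 2 * j)) x).
    { assert (Hnext : forall n, (N <= n)%nat -> iter_f g n x < iter_f g (S n) x ->
        iter_f g (S (S n)) x < iter_f g (S n) x /\
        iter_f g (S (S n)) x < iter_f g (S (S (S n))) x).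
      { intros n Hn Hup. assert (Hd := HN1 n ltac:(lia) Hup). split; [assumption|].
        specialize (HN2 (S n) ltac:(lia)).
        rewrite !iter_mirror, Ropp_involutive in HN2. lra. }
      induction j as [|j [IHu IHd]].
      - rewrite Nat.add_0_r. destruct (Hnext N); auto; lra.
      - replace (N + 2 * S j)%nat with (S (S (N + 2 * j))) by lia.
        destruct (Hnext (N + 2 * j)%nat) as [_ Hu]; auto; [lia|].
        destruct (Hnext (S (S (N + 2 * j)))) as [Hd' _]; auto; lia. }
    (* The separating point is the supremum of the ascending points; each descending point bounds
       them all. *)
    destruct (completeness (fun r => exists j, r = iter_f g (N + 2 * j) x)) as [s [Hub Hlub]].
    + exists M. intros r [j ->]. apply HM.
    + now exists (iter_f g (N + 2 * 0) x), O.
    + exists s, N. intro j. split; [apply Hub; now exists j|].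
      apply Hlub. intros r [i ->]. left.
      apply ascending_left_of_descending; auto; apply Halt.
Qed.

(** * Widths of orbit tails along residue classes of times *)

Definition tail_width (f : R -> R) (x : R) (K i : nat) (a : R) : Prop :=
  exists N l, forall j, (N <= j)%nat -> l <= iter_f f (K * j + i) x <= l + a.

Lemma tail_width_refine (f : R -> R) (x : R) (K i K' i' : nat) (a : R) :
  (exists q r, (1 <= q)%nat /\ K' = (K * q)%nat /\ i' = (i + K * r)%nat) ->
  tail_width f x K i a -> tail_width f x K' i' a.
Proof.
  intros (q & r & Hq & -> & ->) (N & l & H). exists N, l. intros j Hj.
  replace (K * q * j + (i + K * r))%nat with (K * (q * j + r) + i)%nat by lia.
  apply H. nia.
Qed.

Lemma tail_width_split (f : R -> R) (x : R) (K i : nat) (a M : R) :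
  continuity f -> odd_periods_trivial (iter_f f K) ->
  (forall n, - M <= iter_f f n x <= M) -> 0 <= a -> tail_width f x K i a ->
  exists a1 a2, 0 <= a1 /\ 0 <= a2 /\ a1 + a2 = a /\
    tail_width f x (K * 2) i a1 /\ tail_width f x (K * 2) (i + K) a2.
Proof.
  intros Hf Hodd HM Ha Hw.
  assert (Hy : forall n, iter_f (iter_f f K) n (iter_f f i x) = iter_f f (K * n + i) x).
  { intro n. now rewrite iter_f_mul, iter_f_add. }
  destruct (cv_or_alternating (iter_f f K) (iter_f f i x) M) as [[l Hl]|(z & P & Hz)]; auto.
  - now apply continuity_iter_f.
  - intro n. now rewrite Hy.
  - assert (Hhalf : tail_width f x K i (a / 2)).
    { destruct (Rle_lt_or_eq_dec _ _ Ha) as [Hpos|<-].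
      - destruct (Hl (a / 4)) as (N & HN); [lra|].
        exists N, (l - a / 4). intros j Hj. specialize (HN j Hj).
        rewrite Hy in HN. apply Rabs_def2 in HN. lra.
      - now replace (0 / 2) with 0 by field. }
    exists (a / 2), (a / 2). repeat split; try lra.
    + apply (tail_width_refine f x K i); [|assumption]. exists 2%nat, O. lia.
    + apply (tail_width_refine f x K i); [|assumption]. exists 2%nat, 1%nat. lia.
  - destruct Hw as (N & l & Hw).
    assert (Hz' : forall j, iter_f f (K * (P + 2 * j) + i) x <= z
                         <= iter_f f (K * (S (P + 2 * j)) + i) x).
    { intro j. rewrite <- !Hy. apply Hz. }
    assert (Hlz : l <= z <= l + a).
    { assert (A := Hw (P + 2 * N)%nat ltac:(lia)).
      assert (B := Hw (S (P + 2 * N))%nat ltac:(lia)).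
      specialize (Hz' N). lra. }
    (* The parity of [P] decides which of the two new classes lies below [z]. *)
    destruct (Nat.Even_or_Odd P) as [[p Hp]|[p Hp]].
    + exists (z - l), (l + a - z). repeat split; try lra.
      * exists (N + p)%nat, l. intros j Hj.
        specialize (Hz' (j - p)%nat). specialize (Hw (2 * j)%nat ltac:(lia)).
        replace (P + 2 * (j - p))%nat with (2 * j)%nat in Hz' by lia.
        replace (K * 2 * j + i)%nat with (K * (2 * j) + i)%nat by lia. lra.
      * exists (N + p)%nat, z. intros j Hj.
        specialize (Hz' (j - p)%nat). specialize (Hw (S (2 * j))%nat ltac:(lia)).
        replace (P + 2 * (j - p))%nat with (2 * j)%nat in Hz' by lia.
        replace (K * 2 * j + (i + K))%nat with (K * S (2 * j) + i)%nat by lia. lra.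
    + exists (l + a - z), (z - l). repeat split; try lra.
      * exists (N + p + 1)%nat, z. intros j Hj.
        specialize (Hz' (j - p - 1)%nat). specialize (Hw (2 * j)%nat ltac:(lia)).
        replace (S (P + 2 * (j - p - 1)))%nat with (2 * j)%nat in Hz' by lia.
        replace (K * 2 * j + i)%nat with (K * (2 * j) + i)%nat by lia. lra.
      * exists (N + p + 1)%nat, l. intros j Hj.
        specialize (Hz' (j - p)%nat). specialize (Hw (S (2 * j))%nat ltac:(lia)).
        replace (P + 2 * (j - p))%nat with (S (2 * j))%nat in Hz' by lia.
        replace (K * 2 * j + (i + K))%nat with (K * S (2 * j) + i)%nat by lia. lra.
Qed.

(** The widths for [x] and [y] are added before a class is chosen, so that one choice serves both.
    Initially each is [2 * M], and each splitting at least halves the sum. *)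
Lemma common_narrow_class (f : R -> R) (x y M : R) :
  continuity f -> (forall k, odd_periods_trivial (iter_f f (2 ^ k))) ->
  (forall n, - M <= iter_f f n x <= M) -> (forall n, - M <= iter_f f n y <= M) ->
  forall k, exists i a b, 0 <= a /\ 0 <= b /\ (a + b) * 2 ^ k <= 4 * M /\
    tail_width f x (2 ^ k) i a /\ tail_width f y (2 ^ k) i b.
Proof.
  intros Hf Hodd Hx Hy k. induction k as [|k (i & a & b & Ha & Hb & Hab & Hwx & Hwy)].
  - exists O, (2 * M), (2 * M). assert (HM := Hx O). simpl (2 ^ 0)%R. repeat split; try lra.
    + exists O, (- M). intros j _. specialize (Hx (2 ^ 0 * j + 0)%nat).
      lra.
    + exists O, (- M). intros j _. specialize (Hy (2 ^ 0 * j + 0)%nat).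
      lra.
  - destruct (tail_width_split f x (2 ^ k) i a M) as (a1 & a2 & A1 & A2 & Ea & Wa1 & Wa2); auto.
    destruct (tail_width_split f y (2 ^ k) i b M) as (b1 & b2 & B1 & B2 & Eb & Wb1 & Wb2); auto.
    assert (0 < 2 ^ k) by (apply pow_lt; lra).
    replace (2 ^ S k)%nat with (2 ^ k * 2)%nat by (simpl; lia).
    simpl (2 ^ S k)%R.
    destruct (Rle_dec ((a1 + b1) * 2) (a + b)) as [Hle|Hgt].
    + exists i, a1, b1. repeat split; auto. nra.
    + exists (i + 2 ^ k)%nat, a2, b2. repeat split; auto.
      assert ((a2 + b2) * 2 <= a + b) by lra. nra.
Qed.

(** * From narrow tails to syndetic proximality *)

Lemma uniform_continuity_iterates (f : R -> R) (K : nat) (e : R) :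
  continuity f -> 0 < e ->
  exists d, 0 < d /\ forall s x y, (s <= K)%nat -> I01 x -> I01 y ->
    Rabs (x - y) < d -> Rabs (iter_f f s x - iter_f f s y) < e.
Proof.
  intros Hf He. induction K as [|K (d & Hd & H)].
  - exists e. split; [assumption|]. intros s x y Hs _ _ Hxy.
    now replace s with O by lia.
  - destruct (@Heine_cor2 (iter_f f (S K)) 0 1) with (eps := mkposreal e He)
      as [[d' Hd'] H'].
    + intros t _. now apply continuity_iter_f.
    + simpl in H'. exists (Rmin d d'). split; [now apply Rmin_glb_lt|].
      assert (Rmin d d' <= d /\ Rmin d d' <= d') by (split; [apply Rmin_l|apply Rmin_r]).
      intros s x y Hs Hx Hy Hxy.
      destruct (Nat.eq_dec s (S K)) as [->|].
      * apply H'; auto; lra.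
      * apply H; auto; [lia|lra].
Qed.

Lemma progression_syndetic (P : nat -> Prop) (K i N : nat) :
  (1 <= K)%nat -> (forall j, (N <= j)%nat -> P (K * j + i)%nat) -> syndetic P.
Proof.
  intros HK HP T HT. destruct (HT (K * (N + 2) + i)%nat) as [m Hm].
  assert (E := Nat.div_mod_eq m K). assert (Hr := Nat.mod_upper_bound m K ltac:(lia)).
  set (q := (m / K)%nat) in *. set (r := (m mod K)%nat) in *.
  (* With [m = K * q + r], this term is at offset [K * (N + 1) + i - r] in the run, within its
     length [K * (N + 2) + i]. *)
  exists (K * (q + N + 1) + i)%nat. split; [apply HP; lia|].
  replace (K * (q + N + 1) + i)%nat with (m + (K * (N + 1) + i - r))%nat by nia.
  apply Hm. nia.
Qed.

Lemma proximal_syndetic (f : R -> R) (x y e : R) :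
  maps_I01 f -> continuity f -> (forall k, odd_periods_trivial (iter_f f (2 ^ k))) ->
  Prox f x y -> 0 < e ->
  syndetic (fun n => Rabs (iter_f f n x - iter_f f n y) < e).
Proof.
  intros Hmap Hf Hodd (Hx & Hy & Hprox) He.
  assert (Hin : forall t n, I01 t -> I01 (iter_f f n t)).
  { intros t n Ht. induction n as [|n IH]; [assumption|]. now apply Hmap. }
  (* The 4 is the bound [4 * M] on the initial total width, with [M = 1]. *)
  destruct (cv_pow_half 4 (e / 2)) as (k & Hk); [lra|].
  specialize (Hk k (le_n k)). unfold Rdist in Hk. apply Rabs_def2 in Hk.
  destruct (common_narrow_class f x y 1) with (k := k)
    as (i & a & b & Ha & Hb & Hab & (Nx & lx & Hwx) & (Ny & ly & Hwy)); auto.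
  1, 2: intro n.
  { destruct (Hin x n Hx). lra. }
  { destruct (Hin y n Hy). lra. }
  assert (Hpow : 0 < 2 ^ k) by (apply pow_lt; lra).
  assert (Hab' : a + b < e / 2).
  { assert (a + b <= 4 / 2 ^ k); [|lra].
    apply Rmult_le_reg_r with (2 ^ k); [assumption|]. unfold Rdiv.
    rewrite Rmult_assoc, Rinv_l; lra. }
  set (K := (2 ^ k)%nat) in *.
  assert (HK : (1 <= K)%nat) by (assert (K <> O) by (apply Nat.pow_nonzero; lia); lia).
  destruct (uniform_continuity_iterates f K (e / 2) Hf) as (d & Hd & Huc); [lra|].
  set (N := (Nx + Ny)%nat).
  destruct (Hprox d Hd (K * N + i)%nat) as (n & Hn & Hclose).
  (* From the proximal time [n], at most [K] further steps reach a time of the class, and uniform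
     continuity keeps the pair close. *)
  assert (Hj0 : exists j0, (N <= j0)%nat /\
    Rabs (iter_f f (K * j0 + i) x - iter_f f (K * j0 + i) y) < e / 2).
  { set (m := (n - i)%nat).
    assert (E := Nat.div_mod_eq m K). assert (Hr := Nat.mod_upper_bound m K ltac:(lia)).
    set (q := (m / K)%nat) in *. set (r := (m mod K)%nat) in *.
    exists (S q). split; [nia|].
    replace (K * S q + i)%nat with ((K - r) + n)%nat by nia.
    rewrite !iter_f_add. apply Huc; auto; lia. }
  destruct Hj0 as (j0 & Hj0 & Hd0).
  apply (progression_syndetic _ K i N HK).
  intros j Hj.
  (* From time [j0] to [j] the difference changes by at most [a + b < e / 2]. *)
  assert (A1 := Hwx j0 ltac:(lia)). assert (A2 := Hwx j ltac:(lia)).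
  assert (B1 := Hwy j0 ltac:(lia)). assert (B2 := Hwy j ltac:(lia)).
  apply Rabs_def2 in Hd0. apply Rabs_def1; lra.
Qed.

(** * Extension to the real line and divisibility of periods *)

(** Composing [f] with this retraction gives a map continuous on the whole line, as the lemmas above
    require. *)
Definition clamp (t : R) : R := Rmax 0 (Rmin 1 t).

Lemma clamp_I01 (t : R) : I01 (clamp t).
Proof.
  unfold clamp. split; [apply Rmax_l|].
  apply Rmax_lub; [lra|apply Rmin_l].
Qed.

Lemma clamp_id (t : R) : I01 t -> clamp t = t.
Proof.
  intros [H0 H1]. unfold clamp. rewrite Rmin_right, Rmax_right; auto.
Qed.

Lemma clamp_contraction (s t : R) : Rabs (clamp s - clamp t) <= Rabs (s - t).
Proof.
  unfold clamp, Rmax, Rmin.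
  repeat destruct (Rle_dec _ _); unfold Rabs; repeat destruct (Rcase_abs _); lra.
Qed.

Lemma continuity_clamp_extension (f : R -> R) :
  continuous_on_I01 f -> continuity (fun t => f (clamp t)).
Proof.
  intros Hf t e He.
  destruct (Hf (clamp t) (clamp_I01 t) e He) as (d & Hd & H).
  exists d. split; [assumption|]. intros s [_ Hs].
  apply H; [apply clamp_I01|].
  apply Rle_lt_trans with (2 := Hs), clamp_contraction.
Qed.

Lemma iter_clamp_extension (f : R -> R) (n : nat) (x : R) :
  maps_I01 f -> I01 x ->
  iter_f (fun t => f (clamp t)) n x = iter_f f n x /\ I01 (iter_f f n x).
Proof.
  intros Hmap Hx. induction n as [|n [IH Hin]]; [now split|].
  rewrite !iter_f_S, IH, clamp_id by assumption. split; [reflexivity|now apply Hmap].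
Qed.

(** Take the least period; a nonzero remainder of [n] modulo it would be a smaller one. *)
Lemma prime_period_divides (f : R -> R) (n : nat) (y : R) :
  (1 <= n)%nat -> iter_f f n y = y ->
  exists p, has_prime_period f y p /\ Nat.divide p n.
Proof.
  intros Hn Hy.
  destruct (dec_inh_nat_subset_has_unique_least_element
    (fun p => (1 <= p)%nat /\ iter_f f p y = y)) as (p & [[Hp Ep] Hleast] & _).
  { intro p. apply classic. }
  { now exists n. }
  exists p. split.
  - repeat split; auto. intros k Hk E. specialize (Hleast k (conj (proj1 Hk) E)). lia.
  - assert (E := Nat.div_mod_eq n p). assert (Hr := Nat.mod_upper_bound n p ltac:(lia)).
    set (q := (n / p)%nat) in *. set (r := (n mod p)%nat) in *.
    assert (Hpq : iter_f f (p * q) y = y).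
    { rewrite <- iter_f_mul. now apply iter_f_fixed. }
    rewrite E, Nat.add_comm, iter_f_add, Hpq in Hy.
    destruct (Nat.eq_dec r 0) as [Hr0|Hr0].
    + exists q. lia.
    + specialize (Hleast r ltac:(split; [lia|assumption])). lia.
Qed.

(** The prime period [2 ^ j] divides [2 ^ k] times an odd number, so [j <= k] and the iterate of
    order [2 ^ k] fixes the point. *)
Lemma odd_periods_trivial_of_powers_of_two (f : R -> R) (k : nat) :
  (forall y p, has_prime_period f y p -> exists j, p = (2 ^ j)%nat) ->
  odd_periods_trivial (iter_f f (2 ^ k)).
Proof.
  intros Hper l y Hy. rewrite iter_f_mul in Hy.
  assert (Hk : (2 ^ k <> 0)%nat) by (apply Nat.pow_nonzero; lia).
  destruct (prime_period_divides f (2 ^ k * S (2 * l)) y) as (p & Hp & c & Hc); auto; [nia|].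
  destruct (Hper y p Hp) as (j & ->).
  destruct (Nat.le_gt_cases j k) as [Hjk|Hjk].
  - replace (2 ^ k)%nat with (2 ^ j * 2 ^ (k - j))%nat.
    + rewrite <- iter_f_mul. apply iter_f_fixed, Hp.
    + rewrite <- Nat.pow_add_r. f_equal. lia.
  - exfalso. replace j with (k + (1 + (j - k - 1)))%nat in Hc by lia.
    rewrite !Nat.pow_add_r in Hc. simpl (2 ^ 1)%nat in Hc.
    assert (S (2 * l) = c * (2 * 2 ^ (j - k - 1)))%nat; [|lia].
    apply Nat.mul_cancel_l with (2 ^ k)%nat; [assumption|]. rewrite Hc. ring.
Qed.

Theorem theorem7p11 (f : R -> R)
  (hmap : maps_I01 f) (hcont : continuous_on_I01 f) (htype : type_2_infty f) :
  forall x y : R, Prox f x y <-> SProx f x y.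
Proof.
  intros x y. split.
  - intros (Hx & Hy & Hprox). repeat split; try apply Hx; try apply Hy.
    intros e He. set (g := fun t => f (clamp t)).
    assert (Hg : forall t n, I01 t -> iter_f g n t = iter_f f n t /\ I01 (iter_f f n t)).
    { intros t n. now apply iter_clamp_extension. }
    assert (Hsyn : syndetic (fun n => Rabs (iter_f g n x - iter_f g n y) < e)).
    { apply proximal_syndetic; auto.
      - intros t _. apply hmap, clamp_I01.
      - now apply continuity_clamp_extension.
      - intro k. apply odd_periods_trivial_of_powers_of_two.
        intros t p (Hp & Et & Hmin). apply htype. exists t.
        (* The extension creates no new periodic point, since a periodic point is a value of [g] and
           so lies in the unit interval. *)
        assert (Ht : I01 t).
        { rewrite <- Et. destruct p as [|p]; [lia|].
          rewrite iter_f_S. apply hmap, clamp_I01. }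
        split; [assumption|]. split; [assumption|].
        destruct (Hg t p Ht) as [<- _]. split; [assumption|].
        intros i Hi. destruct (Hg t i Ht) as [<- _]. now apply Hmin.
      - split; [assumption|split; [assumption|]]. intros d Hd N.
        destruct (Hprox d Hd N) as (n & Hn & Hc). exists n. split; [assumption|].
        destruct (Hg x n Hx) as [-> _]. now destruct (Hg y n Hy) as [-> _]. }
    intros T HT. destruct (Hsyn T HT) as (n & Hn & HTn). exists n. split; [|assumption].
    destruct (Hg x n Hx) as [<- _]. now destruct (Hg y n Hy) as [<- _].
  - intros (Hx & Hy & Hs). repeat split; try apply Hx; try apply Hy.
    (* The set of times from [N] on is thick, so the syndetic set meets it. *)
    intros e He N. destruct (Hs e He (fun n => (N <= n)%nat)) as (n & Hn & HN).
    + intro L. exists N. intros i _. lia.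
    + now exists n.
Qed.
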